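(* Let $n$ be a nonnegative integer. Then $b_9(n)$ is divisible by $3$ if and only if at least one of the following conditions holds (where $p$ ranges over prime numbers): \begin{itemize} \item $\#\{p : p\equiv 2\pmod 3,\ \mathrm{ord}_p(3n+1)\text{ is odd}\}\neq 0$; \item $\#\{p : p\equiv 1\pmod 3,\ \mathrm{ord}_p(3n+1)\equiv 2\pmod 3\}\neq 0$. \end{itemize}
   Context: A partition of a positive integer $n$ is a non-increasing sequence of positive integers (called parts) whose sum is $n$. For an integer $l\ge 2$, a partition is $l$-regular if none of its parts is divisible by $l$. $b_l(n)$ denotes the number of $l$-regular partitions of $n$, with the convention $b_l(0)=1$; equivalently, $\sum_{n\ge 0} b_l(n)q^n=\prod_{m\ge 1}\frac{1-q^{lm}}{1-q^m}$. For a prime $p$ and a positive integer $N$, $\mathrm{ord}_p(N)$ denotes the exponent of the highest power of $p$ dividing $N$. *)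

(* Defs.v *)
From mathcomp Require Import all_boot.

Set Implicit Arguments.
Unset Strict Implicit.
Unset Printing Implicit Defensive.

Definition is_partition (n : nat) (s : seq nat) : bool :=
  [&& sorted geq s, all (fun m => 0 < m) s & sumn s == n].

Definition regular (l : nat) (s : seq nat) : bool :=
  all (fun m => ~~ (l %| m)) s.

(* A partition of n has at most n parts, each at most n, so the partitions of
   n all live in the finite type n.-bseq 'I_n.+1 of sequences of length at most
   n with entries at most n; is_partition_bseq checks that none is lost. *)
Definition b (l n : nat) : nat :=
  #|[set s : n.-bseq 'I_n.+1 |
      is_partition n (map val s) && regular l (map val s)]|.

Lemma is_partition_bseq (n : nat) (s : seq nat) :
  is_partition n s -> exists t : n.-bseq 'I_n.+1, map val t = s.
Proof.
case/and3P=> _ s_gt0 /eqP sum_s.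
have size_s : size s <= n.
  rewrite -sum_s; elim: s s_gt0 {sum_s} => //= m s IHs /andP[m_gt0 /IHs le_s].
  by rewrite -add1n leq_add.
have le_n m : m \in s -> m < n.+1.
  rewrite ltnS -sum_s => {s_gt0 sum_s size_s}.
  elim: s => //= k s IHs; rewrite inE => /predU1P[->|/IHs le_m].
    exact: leq_addr.
  exact: leq_trans le_m (leq_addl _ _).
have val_s : map val (map (@inord n) s) = s.
  by rewrite -map_comp map_id_in // => m /le_n lt_m; rewrite /= inordK.
have size_t : size (map (@inord n) s) <= n by rewrite size_map.
by exists (Bseq size_t).
Qed.

(* Main.v *)
Require Import Defs.
From mathcomp Require Import all_boot.
From mathcomp Require Import all_order all_algebra.
From mathcomp Require Import zify ring.

Set Implicit Arguments.
Unset Strict Implicit.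
Unset Printing Implicit Defensive.

Import GRing.Theory Order.TTheory Num.Theory.

(* Write E(q) = prod (1 - q^m) = sum_k (-1)^k q^(k(3k-1)/2), the second equality
   being the pentagonal number theorem. By definition B = sum b_9(n) q^n
   satisfies E(q) B(q) = E(q^9). Modulo 3 the same equation is satisfied by
     C = sum_n c(n) q^n,  c(n) = sum_(d | 3n+1) chi(d),
   where chi is the nontrivial character mod 3. Indeed C is the Lambert series
   sum_(a in Z) q^a / (1 - q^(3a+1)), so E C is a signed sum over points of Z^3;
   sign-reversing involutions cancel all of it but
     sum_k (-1)^k (1 - k) q^(3k(k-1)/2),
   which is E(q^9) mod 3. Since E has constant term 1, b_9(n) = c(n) mod 3, and
   c(n) is the divisor sum sigma(3n+1) mod 3 because chi(d) = d mod 3. Finally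
   sigma is multiplicative and 3 divides 1 + p + ... + p^e iff p = 2 mod 3 and e
   is odd, or p = 1 mod 3 and e = 2 mod 3. *)

(** * Signed sums over boxes of integers *)

Section LambertSeries.
Local Open Scope ring_scope.

(** Terms outside the supports vanish, so [phi] and [psi] need only be mutually inverse between the
    supports; they may map the rest of the ranges anywhere. *)
Lemma reindex_support (T T' : eqType) (V : nmodType) (r : seq T) (r' : seq T')
    (phi : T -> T') (psi : T' -> T) (F : T -> V) (G : T' -> V) :
    uniq r -> uniq r' ->
    (forall x, x \in r -> F x != 0 ->
       [/\ phi x \in r', psi (phi x) = x & G (phi x) = F x]) ->
    (forall y, y \in r' -> G y != 0 ->
       [/\ psi y \in r, phi (psi y) = y & F (psi y) = G y]) ->
  \sum_(x <- r) F x = \sum_(y <- r') G y.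
Proof.
move=> Ur Ur' Fr Gr'.
rewrite (bigID (fun x => F x == 0)) /= big1 ?add0r; last by move=> x /eqP.
rewrite [RHS](bigID (fun y => G y == 0)) /= [X in _ = X + _]big1 ?add0r; last by move=> x /eqP.
rewrite -big_filter -[RHS]big_filter.
transitivity (\sum_(y <- map phi [seq x <- r | F x != 0]) G y).
  rewrite big_map; apply: eq_big_seq => x; rewrite mem_filter => /andP[Fx xr].
  by case: (Fr x xr Fx).
apply/perm_big/uniq_perm; [|exact: filter_uniq|].
  rewrite map_inj_in_uniq ?filter_uniq // => x y.
  rewrite !mem_filter => /andP[Fx xr] /andP[Fy yr] e.
  by case: (Fr x xr Fx) (Fr y yr Fy) => _ <- _ [_ <- _]; rewrite e.
move=> y; rewrite mem_filter; apply/mapP/andP => [[x]|[Gy yr]].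
  by rewrite mem_filter => /andP[Fx /Fr/(_ Fx)[? ? e]] ->; rewrite e.
by case: (Gr' y yr Gy) => ? e e'; exists (psi y); rewrite ?mem_filter ?e' ?Gy.
Qed.

(** Reindexing by [phi] gives [S = - S], and the integers have no 2-torsion. Fixed points are
    harmless, since oddness makes [F] vanish there. *)
Lemma sum_odd_involution (T : eqType) (r : seq T) (phi : T -> T) (F : T -> int) :
    uniq r -> (forall x, F x != 0 -> x \in r) -> involutive phi ->
    (forall x, F (phi x) = - F x) ->
  \sum_(x <- r) F x = 0.
Proof.
move=> Ur Fr phiK Fphi.
suff : \sum_(x <- r) F x = \sum_(x <- r) - F x.
  by rewrite sumrN; set S := \sum_(x <- r) F x => /eqP; rewrite -addr_eq0; lia.
apply: (@reindex_support _ _ _ _ _ phi phi) => // x xr Fx; rewrite phiK Fphi ?opprK.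
  by split=> //; apply: Fr; rewrite Fphi oppr_eq0.
by split=> //; apply: Fr; rewrite Fphi.
Qed.

Fixpoint zball (L : nat) : seq int :=
  if L is L'.+1 then [:: L%:Z, - L%:Z & zball L'] else [:: 0].

Lemma mem_zball L x : (x \in zball L) = (- L%:Z <= x) && (x <= L%:Z).
Proof.
by elim: L => [|L IH]; rewrite /= !inE ?IH; apply/idP/idP; lia.
Qed.

Lemma zball_uniq L : uniq (zball L).
Proof. by elim: L => //= L IH; rewrite !inE !mem_zball IH; lia. Qed.

Definition zcube L : seq (int * int * int) :=
  [seq (p, z) | p <- [seq (x, y) | x <- zball L, y <- zball L], z <- zball L].

Lemma mem_zcube L x y z :
  ((x, y, z) \in zcube L) = [&& x \in zball L, y \in zball L & z \in zball L].
Proof.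
apply/allpairsP/and3P=> [[[p z'] /=]|[xL yL zL]].
  by case=> /allpairsP[[x1 y1] /= [? ? ->]] ? [-> -> ->].
by exists ((x, y), z); split=> //; apply/allpairsP; exists (x, y).
Qed.

Lemma zcube_uniq L : uniq (zcube L).
Proof. by do 2?apply: allpairs_uniq; rewrite ?zball_uniq // => -[? ?] [? ?] _ _ /= [-> ->]. Qed.

Lemma sum_zcube L (F : int * int * int -> int) :
  \sum_(t <- zcube L) F t =
  \sum_(x <- zball L) \sum_(y <- zball L) \sum_(z <- zball L) F (x, y, z).
Proof. by rewrite big_allpairs big_allpairs. Qed.

(** The sign [(-1)^k] for [k] of either sign, linear in the residue so that parity arguments become
    linear arithmetic. *)
Definition sg (k : int) : int := 1 - 2 * (k %% 2)%Z.

(** Generalized pentagonal numbers; [k(3k-1)] is even and nonnegative, so the floor and the absolute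
    value change nothing. *)
Definition pent (k : int) : nat := `|(k * (3 * k - 1) %/ 2)%Z|%N.

Lemma pent2 k : 2 * (pent k)%:Z = k * (3 * k - 1).
Proof.
have [j kj] : exists j, k = 2 * j \/ k = 2 * j + 1 by exists (k %/ 2)%Z; lia.
have j1 : 0 <= j * (6 * j - 1).
  case: (lerP 1 j) => ?; first by apply: mulr_ge0; lia.
  by rewrite -mulrNN; apply: mulr_ge0; lia.
have j2 : 0 <= (2 * j + 1) * (3 * j + 1).
  case: (lerP 0 j) => ?; first by apply: mulr_ge0; lia.
  by rewrite -mulrNN; apply: mulr_ge0; lia.
rewrite /pent; case: kj => ->.
  rewrite (_ : 2 * j * (3 * (2 * j) - 1) = 2 * (j * (6 * j - 1))); last by ring.
  by rewrite mulKz //; lia.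
rewrite (_ : (2 * j + 1) * (3 * (2 * j + 1) - 1) = 2 * ((2 * j + 1) * (3 * j + 1))); last by ring.
by rewrite mulKz //; lia.
Qed.

(** * The product of E and the Lambert series *)

(* The point (k0, a, b) of the expansion of E C has sign (-1)^k0 and degree
   k0(3k0-1)/2 + 3ab + a + b; it is recorded here as (a, i, k) with k0 = a + k
   and b = i - k, and degrees are doubled. [cone_term] is the original weight:
   q^a / (1 - q^(3a+1)) has coefficients 1 for b >= 0 if a >= 0, and -1 for b < 0
   if a < 0. The difference of [cone_term] and [wedge_term] is odd under
   k -> 1 - k, the reflection a -> -a - 2i carries [wedge_term] to [mirror_term],
   and off the plane a = 0 the latter is the difference of [diag_term], odd under
   (i, k) -> (1 - 2a + i - 2k, 1 - 2a - k), and [axis_term], odd under k -> 1 - k.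
   The weights are chosen so that every one of these sums is finite. *)
Definition cone_term (n : int) (t : int * int * int) : int := let: (a, i, k) := t in
  if 3*k*(k-1) + 3*a*(a-1) + 6*a*i + 4*a + 2*i == 2*n
  then sg (a + k) * ((k <= i)%R%:Z - (a < 0)%R%:Z) else 0.

Definition wedge_term (n : int) (t : int * int * int) : int := let: (a, i, k) := t in
  if 3*k*(k-1) + 3*a*(a-1) + 6*a*i + 4*a + 2*i == 2*n
  then sg (a + k) * ((k <= i)%R%:Z - (0 < i)%R%:Z) else 0.

Definition mirror_term (n : int) (t : int * int * int) : int := let: (a, i, k) := t in
  if 3*k*(k-1) + 3*a*(a-1) + 6*a*i + 2*a == 2*n
  then sg (a + k) * ((k <= i)%R%:Z - (0 < i)%R%:Z) else 0.

Definition diag_term (n : int) (t : int * int * int) : int := let: (a, i, k) := t in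
  if 3*k*(k-1) + 3*a*(a-1) + 6*a*i + 2*a == 2*n
  then sg (a + k) * ((0 < a)%R%:Z * (k <= i)%R%:Z - (a < 0)%R%:Z * (i < k)%R%:Z) else 0.

Definition axis_term (n : int) (t : int * int * int) : int := let: (a, i, k) := t in
  if 3*k*(k-1) + 3*a*(a-1) + 6*a*i + 2*a == 2*n
  then sg (a + k) * ((0 < a)%R%:Z * (0 < i)%R%:Z - (a < 0)%R%:Z * (i <= 0)%R%:Z) else 0.

Lemma if_neq0 (c : bool) (x y : int) : (if c then x * y else 0) != 0 -> c /\ y != 0.
Proof. by case: c => //; rewrite mulf_eq0 negb_or => /andP[]. Qed.

Lemma mul_pred_ge0 (k : int) : 0 <= k * (k - 1).
Proof.
case: (lerP 1 k) => k1; first by apply: mulr_ge0; lia.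
have : 0 <= (- k) * (- k) by apply: mulr_ge0; lia.
lia.
Qed.

Lemma mul_pred_bound (k m : int) : k * (k - 1) <= m -> - m <= k <= m + 1.
Proof.
move=> km; case: (lerP 1 k) => k1.
  have : 0 <= (k - 1) * (k - 1) by apply: mulr_ge0; lia.
  lia.
have : 0 <= (- k) * (- k) by apply: mulr_ge0; lia.
lia.
Qed.

(** The weights differ only for [a >= 0, i > 0] or [a < 0, i <= 0]. In both regions [a * i >= 0],
    and the degree bounds all three coordinates. *)
Lemma cone_wedge_support n t : cone_term n t != wedge_term n t -> let: (a, i, k) := t in
  [/\ - (2*n+2) <= a <= 2*n+2, - (2*n+2) <= i <= 2*n+2 & - (2*n+2) <= k <= 2*n+2].
Proof.
case: t => [[a i] k]; rewrite /cone_term /wedge_term.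
case: (_ =P 2 * n) => [e|]; rewrite ?eqxx // => w.
have {}w : (k <= i)%R%:Z - (a < 0)%R%:Z != (k <= i)%R%:Z - (0 < i)%R%:Z.
  by apply: contra_neq w => ->.
have {}w : (0 < i /\ 0 <= a) \/ (i <= 0 /\ a < 0) by lia.
have := mul_pred_ge0 k; have := mul_pred_ge0 a => ta tk.
case: w => -[i0 a0].
  have ai : 0 <= a * i by apply: mulr_ge0; lia.
  by have := @mul_pred_bound k (2*n); split; lia.
have ai : 0 <= (-1-a) * (-i) by apply: mulr_ge0; lia.
have aa : 0 <= (-1-a) * (-a) by apply: mulr_ge0; lia.
by have := @mul_pred_bound k (2*n); split; lia.
Qed.

(** With [s = a + i] the doubled degree is [3s^2 + s + 3(k^2 - i^2) - 3k + i]. The weight lives on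
    [k <= i <= 0] and [0 < i < k], where [k] dominates [i] and the indefinite form becomes bounded
    below. *)
Lemma wedge_support n t : wedge_term n t != 0 -> let: (a, i, k) := t in
  [/\ - (2*n+3) <= a + i <= 2*n+3, - (2*n+3) <= i <= 2*n+3 & - (2*n+3) <= k <= 2*n+3].
Proof.
case: t => [[a i] k] /if_neq0[/eqP e w].
have {}w : (k <= i /\ i <= 0) \/ (i < k /\ 0 < i) by lia.
have c1 : 0 <= (a + i) * (a + i - 1) by apply: mul_pred_ge0.
have c2 : 0 <= (a + i + 1) * (a + i + 1 - 1) by apply: mul_pred_ge0.
case: w => -[ki i0].
  have : 0 <= (i - k) * (- k - i) by apply: mulr_ge0; lia.
  by split; lia.
have : 0 <= (k - i - 1) * (k + i - 1) by apply: mulr_ge0; lia.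
by split; lia.
Qed.

(** In [s = a + i] the two degrees are [3s^2 + s] and [3s^2 - s] plus the same function of [i] and
    [k]; the reflection sends [s] to [-s] and keeps the parity of [a + k]. *)
Lemma wedge_mirror n t : wedge_term n t = let: (a, i, k) := t in mirror_term n (- a - 2 * i, i, k).
Proof.
case: t => [[a i] k]; rewrite /wedge_term /mirror_term.
rewrite [X in _ = if X == _ then _ else _](_ : _ =
  3*k*(k-1) + 3*a*(a-1) + 6*a*i + 4*a + 2*i); last by ring.
by rewrite (_ : sg (- a - 2 * i + k) = sg (a + k)) // /sg; lia.
Qed.

Lemma mirror_support n t : mirror_term n t != 0 -> let: (a, i, k) := t in
  [/\ - (4*n+6) <= a <= 4*n+6, - (2*n+3) <= i <= 2*n+3 & - (2*n+3) <= k <= 2*n+3].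
Proof.
case: t => [[a i] k] nz.
have := @wedge_support n (- a - 2 * i, i, k); rewrite wedge_mirror.
rewrite (_ : - (- a - 2 * i) - 2 * i = a); last by ring.
by case/(_ nz) => *; split; lia.
Qed.

(** The doubled degree equals [3(a+k)(a+k-1) + 6a(i-k) + 2a], and [a(i-k) >= 0] on the support. *)
Lemma diag_support n t : diag_term n t != 0 -> let: (a, i, k) := t in
  [/\ - (2*n+6) <= a <= 2*n+6, - (6*n+20) <= i <= 6*n+20 & - (6*n+20) <= k <= 6*n+20].
Proof.
case: t => [[a i] k] /if_neq0[/eqP e w].
have {}w : (k <= i /\ 0 < a) \/ (i < k /\ a < 0) by lia.
have c1 : 0 <= (a + k) * (a + k - 1) by apply: mul_pred_ge0.
have := @mul_pred_bound (a + k) (2*n+6).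
case: w => -[ki i0].
  have : 0 <= (a - 1) * (i - k) by apply: mulr_ge0; lia.
  by split; lia.
have : 0 <= (- a - 1) * (k - i - 1) by apply: mulr_ge0; lia.
by split; lia.
Qed.

(** For [a > 0] the indicator of [k <= i] cancels; for [a < 0] it adds up to 1 with that of [i < k].
    Either way the weight left over is free of [k]. *)
Lemma axis_termE n t : axis_term n t = diag_term n t - (if t.1.1 == 0 then 0 else mirror_term n t).
Proof.
case: t => [[a i] k]; rewrite /mirror_term /diag_term /axis_term /=.
case: (_ == 2 * n); last by case: ifP.
case: eqP => a0; rewrite -?mulrBr ?subr0; congr (_ * _); lia.
Qed.

Lemma sum_cone_wedge L (n : int) : 0 <= n -> 6*n+20 <= L%:Z ->
  \sum_(t <- zcube L) cone_term n t = \sum_(t <- zcube L) wedge_term n t.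
Proof.
move=> n0 nL; apply/subr0_eq; rewrite -sumrB.
apply: (@sum_odd_involution _ _ (fun t => let: (a, i, k) := t in (a, i, 1 - k))).
- exact: zcube_uniq.
- move=> [[a i] k]; rewrite mem_zcube !mem_zball subr_eq0.
  by move/cone_wedge_support => -[*]; lia.
- by move=> [[a i] k]; rewrite opprB addrC subrK.
- move=> [[a i] k]; rewrite /cone_term /wedge_term.
  have -> : 3*(1-k)*(1-k-1) = 3*k*(k-1) by ring.
  have -> : sg (a + (1 - k)) = - sg (a + k) by rewrite /sg; lia.
  case: eqP => _; last by rewrite subrr oppr0.
  by rewrite -!mulrBr mulNr; congr (- (_ * _)); lia.
Qed.

Lemma sum_wedge_mirror L (n : int) : 0 <= n -> 6*n+20 <= L%:Z ->
  \sum_(t <- zcube L) wedge_term n t = \sum_(t <- zcube L) mirror_term n t.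
Proof.
move=> n0 nL.
pose phi (t : int * int * int) : int * int * int :=
  let: (a, i, k) := t in (- a - 2 * i, i, k).
have phiK : involutive phi by case=> [[a i] k] /=; congr (_, _, _); ring.
have wedgeE t : wedge_term n t = mirror_term n (phi t).
  by rewrite wedge_mirror; case: t => [[a i] k].
apply: (@reindex_support _ _ _ _ _ phi phi); rewrite ?zcube_uniq // => t _ nz.
  split; rewrite ?phiK //; rewrite wedgeE in nz; move/mirror_support: nz.
  by case: t => [[a i] k] /= -[*]; rewrite mem_zcube !mem_zball; lia.
split; rewrite ?wedgeE ?phiK //; have nz2 : wedge_term n (phi t) != 0 by rewrite wedgeE phiK.
case: t nz nz2 => [[a i] k] /mirror_support[? ? ?] /wedge_support[*].
by rewrite mem_zcube !mem_zball; lia.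
Qed.

Lemma sum_diag L (n : int) : 0 <= n -> 6*n+20 <= L%:Z -> \sum_(t <- zcube L) diag_term n t = 0.
Proof.
move=> n0 nL.
(* This map fixes [a] and [i - k] and sends [a + k] to [1 - (a + k)], so it preserves the degree and
   the indicators but flips the sign. *)
apply: (@sum_odd_involution _ _
  (fun t => let: (a, i, k) := t in (a, 1 - 2 * a + i - 2 * k, 1 - 2 * a - k))).
- exact: zcube_uniq.
- by move=> [[a i] k]; rewrite mem_zcube !mem_zball => /diag_support[*]; lia.
- by move=> [[a i] k]; congr (_, _, _); ring.
- move=> [[a i] k]; rewrite /diag_term.
  rewrite [X in (if X == _ then _ else _) = _](_ : _ =
    3*k*(k-1) + 3*a*(a-1) + 6*a*i + 2*a); last by ring.
  rewrite (_ : sg (a + (1 - 2 * a - k)) = - sg (a + k)); last by rewrite /sg; lia.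
  rewrite (_ : (1 - 2 * a - k <= 1 - 2 * a + i - 2 * k) = (k <= i)); last by lia.
  rewrite (_ : (1 - 2 * a + i - 2 * k < 1 - 2 * a - k) = (i < k)); last by lia.
  by case: eqP => _; rewrite ?oppr0 ?mulNr.
Qed.

Lemma sum_axis L (n : int) : 0 <= n -> 6*n+20 <= L%:Z -> \sum_(t <- zcube L) axis_term n t = 0.
Proof.
move=> n0 nL.
apply: (@sum_odd_involution _ _ (fun t => let: (a, i, k) := t in (a, i, 1 - k))).
- exact: zcube_uniq.
- move=> [[a i] k]; rewrite mem_zcube !mem_zball => nz.
  (* A nonzero [axis_term] needs a nonzero [diag_term] or [mirror_term], and both of these have
     bounded support. *)
  have [|/eqP F40] := eqVneq (diag_term n (a, i, k)) 0; last first.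
    by move/eqP/diag_support: F40 => -[*]; lia.
  move: nz; rewrite axis_termE => + e; rewrite e sub0r oppr_eq0; case: ifP => // _.
  by move/mirror_support => -[*]; lia.
- by move=> [[a i] k]; congr (_, _, _); ring.
- move=> [[a i] k]; rewrite /axis_term.
  have -> : 3*(1-k)*(1-k-1) = 3*k*(k-1) by ring.
  have -> : sg (a + (1 - k)) = - sg (a + k) by rewrite /sg; lia.
  by case: eqP => _; rewrite ?oppr0 ?mulNr.
Qed.

Lemma sum_mirror L (n : int) : 0 <= n -> 6*n+20 <= L%:Z ->
  \sum_(t <- zcube L) mirror_term n t =
  \sum_(t <- zcube L) if t.1.1 == 0 then mirror_term n t else 0.
Proof.
move=> n0 nL; pose g (t : int * int * int) : int := if t.1.1 == 0 then mirror_term n t else 0.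
have mirrorE t : mirror_term n t = g t + diag_term n t - axis_term n t.
  by rewrite axis_termE /g; case: ifP => _; ring.
rewrite (eq_bigr _ (fun t _ => mirrorE t)) sumrB big_split /=.
by rewrite sum_diag // sum_axis // addr0 subr0.
Qed.

Lemma sum_ge_zball (L : nat) (k : int) : - L%:Z <= k <= L%:Z + 1 ->
  \sum_(i <- zball L) (k <= i)%R%:Z = L%:Z + 1 - k.
Proof.
elim: L k => [|L IH] k kL; rewrite /= ?big_cons ?big_nil; first by lia.
have [kL'|kL'] := boolP (- L%:Z <= k <= L%:Z + 1); first by rewrite IH //; lia.
have [-> | ->] : k = - L.+1%:Z \/ k = L%:Z + 2 by lia.
  rewrite (@eq_big_seq _ _ _ _ (zball L) _ (fun i => (- L%:Z <= i)%R%:Z)).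
    by rewrite IH; lia.
  by move=> i; rewrite mem_zball; lia.
rewrite big_seq big1; first by lia.
by move=> i; rewrite mem_zball; lia.
Qed.

Lemma sum_cone L (n : int) : 0 <= n -> 6*n+20 <= L%:Z ->
  \sum_(t <- zcube L) cone_term n t =
  \sum_(k <- zball L) if 3*k*(k-1) == 2*n then sg k * (1 - k) else 0.
Proof.
move=> n0 nL; rewrite sum_cone_wedge // sum_wedge_mirror // sum_mirror // sum_zcube /=.
have L0 : (0 : int) \in zball L by rewrite mem_zball; lia.
rewrite (bigD1_seq 0) ?zball_uniq //= [X in _ + X]big1 ?addr0; last first.
  by move=> a /negbTE a0; rewrite big1 // => i _; rewrite big1 // => k _; rewrite a0.
rewrite exchange_big /=; apply: eq_big_seq => k; rewrite mem_zball => kL.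
(* On the plane [a = 0] the degree is free of [i], so [i] is summed out: [L + 1 - k] indices are at
   least [k], and [L] are at least [1]. *)
have -> : 1 - k = \sum_(i <- zball L) ((k <= i)%R%:Z - (1 <= i)%R%:Z).
  by rewrite sumrB !sum_ge_zball; lia.
rewrite (_ : (if _ then _ else _) = \sum_(i <- zball L)
   if 3 * k * (k - 1) == 2 * n then sg k * ((k <= i)%R%:Z - (1 <= i)%R%:Z) else 0).
  apply: eq_bigr => i _; rewrite (add0r k).
  rewrite (_ : 3*k*(k-1) + 3*0*(0-1) + 6*0*i + 2*0 = 3*k*(k-1)); last by ring.
  have -> : (1 <= i) = (0 < i) by lia.
  by [].

by case: ifP => _; rewrite ?mulr_sumr // big1.
Qed.

(** Modulo 3 the factor [1 - k] is 1, 0, -1 for [k] = 0, 1, 2. The class [k = 3l] gives the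
    right-hand sum; the class 2 is stable under the sign-reversing [k -> 1 - k] and cancels. *)
Lemma sum_mul_pred_mod3 L (n : int) : 0 <= n -> 6*n+20 <= L%:Z -> exists z,
  \sum_(k <- zball L) (if 3*k*(k-1) == 2*n then sg k * (1 - k) else 0) =
  \sum_(k <- zball L) (if 9*k*(3*k-1) == 2*n then sg k else 0) + 3 * z.
Proof.
move=> n0 nL.
pose H (k : int) := if 3*k*(k-1) == 2*n then sg k else 0.
have Hbound k : H k != 0 -> - (2*n) <= k <= 2*n+1.
  rewrite /H; case: (_ =P 2 * n) => // e _; apply: mul_pred_bound.
  by have := mul_pred_ge0 k; lia.
exists (\sum_(k <- zball L) - H k * (k %/ 3)%Z).
transitivity (\sum_(k <- zball L) (if (k %% 3)%Z == 0 then H k else 0)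
   - \sum_(k <- zball L) (if (k %% 3)%Z == 2 then H k else 0)
   + 3 * \sum_(k <- zball L) - H k * (k %/ 3)%Z).
  rewrite mulr_sumr -sumrB -big_split /=; apply: eq_bigr => k _.
  rewrite /H; case: ifP => _; last by rewrite !if_same; ring.
  have : 1 - k = ((k %% 3)%Z == 0)%:Z - ((k %% 3)%Z == 2)%:Z - 3 * (k %/ 3)%Z by lia.
  move=> ->; case: (_ =P 0) => [k0|_]; case: (_ =P 2) => [k2|_];
    [exfalso; lia | by rewrite /=; ring ..].
congr (_ + _); rewrite [X in _ - X](_ : _ = 0) ?subr0.
  apply: (@reindex_support _ _ _ _ _ (fun k => (k %/ 3)%Z) (fun l => 3 * l));
    rewrite ?zball_uniq // => k; rewrite mem_zball => kL.
    case: ((_ %% 3)%Z =P 0) => // k3 _; have [l kE] : exists l, k = 3 * l by exists (k %/ 3)%Z; lia.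
    rewrite kE in kL *; rewrite mulKz // mem_zball; split=> //; first by lia.
    rewrite /H (_ : 3 * (3 * l) * (3 * l - 1) = 9 * l * (3 * l - 1)); last by ring.
    by rewrite (_ : sg (3 * l) = sg l) // /sg; lia.
  case: (_ =P 2 * n) => // e nz; have HE : H (3 * k) = sg k.
    rewrite /H (_ : 3 * (3 * k) * (3 * k - 1) = 9 * k * (3 * k - 1)); last by ring.
    by rewrite e eqxx /sg; lia.
  rewrite mem_zball; split; [|lia|].
    by have := Hbound (3 * k); rewrite HE => /(_ nz); lia.
  by rewrite HE; case: eqP => //; lia.
apply: (@sum_odd_involution _ _ (fun k => 1 - k)) => [|k|k|k].
- exact: zball_uniq.
- by case: ifP => // _ /Hbound; rewrite mem_zball; lia.
- by ring.
- rewrite (_ : ((1 - k) %% 3)%Z == 2 = ((k %% 3)%Z == 2)); last by lia.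
  case: ifP => _; rewrite ?oppr0 // /H.
  rewrite (_ : 3 * (1 - k) * (1 - k - 1) = 3 * k * (k - 1)); last by ring.
  by case: ifP => _; rewrite ?oppr0 // /sg; lia.
Qed.

(** * Lambert coefficients as character sums over divisors *)

Definition lambert_coef (L : nat) (m : int) : int :=
  \sum_(a <- zball L) \sum_(b <- zball L)
    if 3*a*b + a + b == m then (0 <= b)%R%:Z - (a < 0)%R%:Z else 0.

Lemma pair_support (a b m : int) :
    (if 3*a*b + a + b == m then (0 <= b)%R%:Z - (a < 0)%R%:Z else 0) != 0 ->
  - m <= a <= m /\ - m <= b <= m.
Proof.
case: (_ =P m) => // e w.
have {}w : (0 <= b /\ 0 <= a) \/ (b < 0 /\ a < 0) by lia.
case: w => -[i0 a0].
  by have ai : 0 <= a * b by [apply: mulr_ge0; lia]; split; lia.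
by have ai : 0 <= (-1-a) * (-1-b) by [apply: mulr_ge0; lia]; split; lia.
Qed.

Lemma sum_sg_lambert_coef L (n : int) : 0 <= n -> 6*n+20 <= L%:Z ->
  \sum_(k <- zball L) sg k * lambert_coef L (n - (pent k)%:Z) =
  \sum_(t <- zcube L) cone_term n t.
Proof.
move=> n0 nL.
pose F0 (t : int * int * int) : int := let: (k, a, b) := t in sg k *
  if 3*a*b + a + b == n - (pent k)%:Z then (0 <= b)%R%:Z - (a < 0)%R%:Z else 0.
have -> : \sum_(k <- zball L) sg k * lambert_coef L (n - (pent k)%:Z) =
          \sum_(t <- zcube L) F0 t.
  rewrite sum_zcube; apply: eq_bigr => k _; rewrite mulr_sumr; apply: eq_bigr => a _.
  by rewrite mulr_sumr; apply: eq_bigr.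
have F0_support t : F0 t != 0 -> let: (k, a, b) := t in
    [/\ - n <= k <= n, - n <= a <= n & - n <= b <= n].
  case: t => [[k a] b]; rewrite /F0 mulf_eq0 negb_or => /andP[_ /pair_support].
  have := mul_pred_ge0 k; have := mul_pred_ge0 (k + 1); have := pent2 k => ? ? ? [? ?].
  by split; lia.
pose phi (t : int * int * int) : int * int * int := let: (k, a, b) := t in (a, k - a + b, k - a).
pose psi (t : int * int * int) : int * int * int := let: (a, i, k) := t in (a + k, a, i - k).
have phiK : cancel phi psi by case=> [[k a] b] /=; congr (_, _, _); ring.
have psiK : cancel psi phi by case=> [[k a] b] /=; congr (_, _, _); ring.
have coneE t : cone_term n t = F0 (psi t).
  case: t => [[a i] k]; rewrite /F0 /cone_term /=.
  rewrite (_ : (3*a*(i-k) + a + (i-k) == _) = (3*k*(k-1) + 3*a*(a-1) + 6*a*i + 4*a + 2*i == 2*n)).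
    by case: ifP => _; rewrite ?mulr0 // subr_ge0.
  by have := pent2 (a + k) => ?; apply/eqP/eqP => ?; lia.
apply: (@reindex_support _ _ _ _ _ phi psi); rewrite ?zcube_uniq // => t _ nz.
  split; rewrite ?coneE ?phiK //.
  by case: t nz => [[a i] k] /F0_support[*]; rewrite mem_zcube !mem_zball; lia.
split; rewrite ?psiK ?coneE //; rewrite coneE in nz.
by case: t nz => [[a i] k] /F0_support[*]; rewrite mem_zcube !mem_zball; lia.
Qed.

Definition chi3 (d : nat) : int := (d %% 3 == 1)%N%:Z - (d %% 3 == 2)%N%:Z.

Definition chi3_sum (m : nat) : int := \sum_(d <- divisors (3 * m + 1)) chi3 d.

(** Since [3(3ab + a + b) + 1 = (3a + 1)(3b + 1)], solutions correspond to divisors [d] of [3m + 1]: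
    [3a + 1 = d] when [d] is 1 mod 3 and [3a + 1 = -d] when [d] is 2 mod 3. The cofactor lies in the
    same class, which gives [a] and [b] matching signs. *)
Lemma lambert_coef_chi3_sum (L m : nat) : (m <= L)%N -> lambert_coef L m%:Z = chi3_sum m.
Proof.
move=> mL.
pose F (t : int * int) : int := let: (a, b) := t in
  if 3*a*b + a + b == m%:Z then (0 <= b)%R%:Z - (a < 0)%R%:Z else 0.
have -> : lambert_coef L m%:Z = \sum_(t <- [seq (a, b) | a <- zball L, b <- zball L]) F t.
  by rewrite big_allpairs.
pose N := (3 * m + 1)%N.
pose phi (t : int * int) : nat := `|(3 * t.1 + 1)%R|%N.
pose psi (d : nat) : int * int := if (d %% 3 == 1)%N then ((d %/ 3)%N%:Z, (N %/ d %/ 3)%N%:Z)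
  else (- (d %/ 3)%N%:Z - 1, - (N %/ d %/ 3)%N%:Z - 1).
apply: (@reindex_support _ _ _ _ _ phi psi); rewrite ?divisors_uniq //.
- by apply: allpairs_uniq; rewrite ?zball_uniq // => -[? ?] [? ?] _ _ /= [-> ->].
- move=> [a b] _ nz; have [aL bL] := @pair_support a b m%:Z nz.
  move: nz; rewrite /F; case: (_ =P m%:Z) => // e w.
  have {}w : (0 <= b /\ 0 <= a) \/ (b < 0 /\ a < 0) by lia.
  have eN : N = (`|(3 * b + 1)%R| * `|(3 * a + 1)%R|)%N.
    apply/eqP; rewrite -eqz_nat PoszM !abszE -normrM ger0_norm /N.
      by apply/eqP; lia.
    by lia.
  have a1 : (0 < `|(3 * a + 1)%R|)%N by lia.
  rewrite /phi /=; split.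
  + by rewrite -dvdn_divisors /=; [rewrite -/N eN dvdn_mull | lia].
  + rewrite /psi eN mulnK //.
    by case: w => -[? ?]; case: ifP => ?; congr (_, _); lia.
  + by rewrite /chi3; lia.
- move=> d; rewrite -dvdn_divisors; last by lia.
  move=> /dvdnP[e]; rewrite -/N => eN nz.
  have d0 : (0 < d)%N by lia.
  have e0 : (0 < e)%N by lia.
  rewrite /phi /psi eN mulnK //.
  have de3 : (d %% 3 = 1 /\ e %% 3 = 1 \/ d %% 3 = 2 /\ e %% 3 = 2)%N.
    have : ((e %% 3) * (d %% 3) %% 3 = 1)%N by rewrite modnMm -eN /N; lia.
    have : (d %% 3 < 3)%N by rewrite ltn_mod.
    have : (e %% 3 < 3)%N by rewrite ltn_mod.
    by case: (e %% 3)%N => [|[|[|]]] //; case: (d %% 3)%N => [|[|[|]]] //; lia.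
  pose x := (d %/ 3)%N; pose y := (e %/ 3)%N; rewrite -/x -/y.
  case: de3 => -[d3 e3]; rewrite d3 /=.
    have dE : d = (3 * x + 1)%N by rewrite /x; lia.
    have eE : e = (3 * y + 1)%N by rewrite /y; lia.
    have mE : m = (3 * x * y + x + y)%N by move: eN; rewrite dE eE /N; lia.
    split; [|lia|].
      by apply/allpairsP; exists (x%:Z, y%:Z); rewrite /= !mem_zball; split=> //; nia.
    by rewrite /chi3 d3 (_ : _ == _); lia.
  have dE : d = (3 * x + 2)%N by rewrite /x; lia.
  have eE : e = (3 * y + 2)%N by rewrite /y; lia.
  have mE : m = (3 * x * y + 2 * x + 2 * y + 1)%N by move: eN; rewrite dE eE /N; lia.
  split; [|lia|].
    by apply/allpairsP; exists (- x%:Z - 1, - y%:Z - 1); rewrite /= !mem_zball; split=> //; nia.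
  by rewrite /chi3 d3 (_ : _ == _); lia.
Qed.

(** For large [L], the coefficient of [q^n] in [E(q)] times the generating series of [f]. *)
Definition pent_conv (L : nat) (f : nat -> int) (n : nat) : int :=
  \sum_(k <- zball L) if (pent k <= n)%N then sg k * f (n - pent k)%N else 0.

Lemma pent_conv_chi3_sum (L n : nat) : (6 * n + 20 <= L)%N -> exists z,
  pent_conv L chi3_sum n = \sum_(k <- zball L) (if (9 * pent k == n)%N then sg k else 0) + 3 * z.
Proof.
move=> nL; have n0 : (0 : int) <= n%:Z by [].
have {}nL : 6 * n%:Z + 20 <= L%:Z by lia.
have [z zE] := sum_mul_pred_mod3 n0 nL; exists z.
have <- : \sum_(k <- zball L) (if 9*k*(3*k-1) == 2*n%:Z then sg k else 0) =
          \sum_(k <- zball L) (if (9 * pent k == n)%N then sg k else 0).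
  apply: eq_bigr => k _; rewrite (_ : (_ == _) = (9 * pent k == n)%N) //.
  by have := pent2 k => e; apply/eqP/eqP => ?; lia.
rewrite -zE -sum_cone // -sum_sg_lambert_coef //; apply: eq_bigr => k _; case: leqP => kn.
  by rewrite subzn // lambert_coef_chi3_sum //; lia.
(* For [pent k > n] the degree is negative and no pair [(a, b)] contributes. *)
rewrite /lambert_coef big1 ?mulr0 // => a _; rewrite big1 // => b _.
by apply/eqP; apply: contraTT isT => /pair_support; lia.
Qed.

End LambertSeries.

(** * Counting regular partitions *)

(** Parts are bounded by [M], and the branching asks whether the largest part equals [M]. Each call
    lowers [M + n], so fuel above [M + n] suffices. *)
Fixpoint regular_partitions (l fuel M n : nat) : seq (seq nat) :=
  if fuel is k.+1 then
    if M is M'.+1 then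
      regular_partitions l k M' n ++
      (if ~~ (l %| M) && (M <= n) then map (cons M) (regular_partitions l k M (n - M)) else [::])
    else if n == 0 then [:: [::]] else [::]
  else [::].

Lemma mem_regular_partitions l fuel M n s : M + n < fuel ->
  (s \in regular_partitions l fuel M n) =
  [&& is_partition n s, regular l s & all (leq^~ M) s].
Proof.
elim: fuel M n s => // k IH [|M] n s kMn.
  rewrite /=; case: s => [|x s].
    by rewrite /is_partition /= andbT eq_sym; case: eqP.
  rewrite (_ : (x :: s \in _) = false); last by case: eqP.
  by rewrite /is_partition; case: x => [|x] /=; rewrite !andbF.
rewrite /= mem_cat IH; last by lia.
case: s => [|x s].
  rewrite (_ : ([::] \in (if _ then _ else _)) = false) ?orbF //.
  by case: ifP => // _; apply/mapP => -[].
rewrite /is_partition /=.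
have -> : (x :: s \in (if ~~ (l %| M.+1) && (M < n)
    then [seq M.+1 :: i | i <- regular_partitions l k M.+1 (n - M.+1)] else [::])) =
  [&& x == M.+1, ~~ (l %| M.+1), M < n & s \in regular_partitions l k M.+1 (n - M.+1)].
  case: ifP => [/andP[-> ->]|/negbT]; last first.
    rewrite negb_and => /orP[/negbTE->|/negbTE->]; rewrite ?andbF //.
  apply/mapP/andP => [[t tin [-> ->]]|[/eqP-> sin]]; first by rewrite eqxx tin.
  by exists s.
have geq_tr : transitive geq by move=> ? ? ? /[swap]; apply: leq_trans.
rewrite (path_sortedE geq_tr).
have [->|xM] := eqVneq x M.+1; last first.
  rewrite /= orbF (_ : (x <= M.+1) = (x <= M)); last by lia.
  case xM': (x <= M); last by rewrite /= ?andbF.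
  case sx : (all (geq x) s); last by rewrite /= ?andbF.
  have -> : all (leq^~ M) s by apply: sub_all sx => y /= /leq_trans; apply.
  by have -> : all (leq^~ M.+1) s by apply: sub_all sx => y /= /leq_trans; apply; lia.
rewrite ltnn !andbF /=; case: (leqP n M) => Mn.
  by rewrite (_ : (M.+1 + sumn s == n) = false) ?andbF //; apply/negbTE; lia.
rewrite IH /is_partition /=; last by lia.
rewrite (_ : (M.+1 + sumn s == n) = (sumn s == n - M.+1)) ?ltnSn; last by lia.
have -> : all (geq M.+1) s = all (leq^~ M.+1) s by [].
case: (all _ s); case: (sorted _ s); case: (all _ s); case: (_ == _);
  by case: (l %| _) => //=; rewrite ?andbF ?andbT.
Qed.

Lemma regular_partitions_uniq l fuel M n : M + n < fuel -> uniq (regular_partitions l fuel M n).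
Proof.
elim: fuel M n => // k IH [|M] n kMn /=; first by case: ifP.
rewrite cat_uniq IH /=; last by lia.
case: ifP => //= /andP[_ Mn]; rewrite map_inj_uniq; last by move=> ? ? [].
rewrite IH ?andbT; last by lia.
apply/hasPn => _ /mapP[t _ ->]; rewrite mem_regular_partitions; last by lia.
by rewrite /= ltnn !andbF.
Qed.

Definition nb_regular l M n := size (regular_partitions l (M + n).+1 M n).

Lemma size_regular_partitions l fuel M n : M + n < fuel ->
  size (regular_partitions l fuel M n) = nb_regular l M n.
Proof.
move=> lt; apply/perm_size/uniq_perm; rewrite ?regular_partitions_uniq // => s.
by rewrite !mem_regular_partitions.
Qed.

Lemma nb_regular0 l n : nb_regular l 0 n = (n == 0).
Proof. by rewrite /nb_regular /=; case: eqP. Qed.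

Lemma nb_regularS l M n : nb_regular l M.+1 n = nb_regular l M n +
  (if ~~ (l %| M.+1) && (M < n) then nb_regular l M.+1 (n - M.+1) else 0).
Proof.
have [k kE] : exists k, M.+1 + n = k by exists (M.+1 + n).
rewrite -(@size_regular_partitions l k.+1) ?kE //=.
rewrite size_cat size_regular_partitions; last by lia.
by case: ifP => // /andP[_ Mn]; rewrite size_map size_regular_partitions; last by lia.
Qed.

Lemma b_nb_regular l M n : n <= M -> b l n = nb_regular l M n.
Proof.
move=> nM; rewrite /b cardE /nb_regular -(size_map (fun s : n.-bseq 'I_n.+1 => map val s)).
apply/perm_size/uniq_perm; rewrite ?regular_partitions_uniq //.
  by rewrite map_inj_uniq ?enum_uniq // => s t /(inj_map val_inj) st; apply: val_inj.
move=> s; rewrite mem_regular_partitions //; apply/mapP/and3P.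
  move=> [t]; rewrite mem_enum inE => /andP[pt rt] ->; split=> //.
  by apply/allP => _ /mapP[i _ ->]; apply: leq_trans nM; rewrite -ltnS ltn_ord.
move=> [ps rs _]; have [t ts] := is_partition_bseq ps.
by exists t; rewrite // mem_enum inE ts ps.
Qed.

(** * The pentagonal number theorem *)

Section Pentagonal.
Local Open Scope ring_scope.

(** Congruence modulo ['X^K], which replaces equality of power series. *)
Definition eqX (K : nat) (p q : {poly int}) := forall i, (i < K)%N -> p`_i = q`_i.

Lemma eqX_trans K p q r : eqX K p q -> eqX K q r -> eqX K p r.
Proof. by move=> pq qr i iK; rewrite pq ?qr. Qed.

Lemma eqX_mul K p q r : eqX K p q -> eqX K (p * r) (q * r).
Proof.
move=> pq i iK; rewrite !coefM; apply: eq_bigr => j _; rewrite pq //.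
by apply: leq_ltn_trans iK; rewrite -ltnS.
Qed.

(** For [s <= n], the quotient [(q)_n / (q)_s] of q-Pochhammer symbols. *)
Definition euler_prod (s n : nat) : {poly int} := \prod_(s <= i < n) (1 - 'X^(i.+1)).

(* Shanks' telescoping sum: its s = 0 term is E up to q^n, and it equals a
   partial sum of the pentagonal series exactly. *)
Definition shanks_sum (n : nat) : {poly int} :=
  \sum_(0 <= s < n.+1) (-1) ^+ s * euler_prod s n * 'X^(s * n + 'C(s.+1, 2)).

(** Expanding the factor [1 - q^(n+1)] turns the new term [s] into [u s - v s]. As [u 0 = f 0] and
    [u s.+1 - v s = f s.+1], the old sum reappears, and what remains is [- v n] and the new last
    term. *)
Lemma shanks_sumS n : shanks_sum n.+1 = shanks_sum n +
  (-1) ^+ n.+1 * ('X^(n.+1 * n.+1 + 'C(n.+1, 2)) + 'X^(n.+1 * n.+1 + 'C(n.+2, 2))).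
Proof.
pose f s : {poly int} := (-1) ^+ s * euler_prod s n * 'X^(s * n + 'C(s.+1, 2)).
pose u s : {poly int} := (-1) ^+ s * euler_prod s n * 'X^(s * n.+1 + 'C(s.+1, 2)).
pose v s : {poly int} := (-1) ^+ s * euler_prod s n * 'X^(s.+1 * n.+1 + 'C(s.+1, 2)).
have fu s : (s < n)%N -> f s.+1 - u s.+1 = - v s.
  move=> sn; rewrite /f /u /v [euler_prod s n]big_ltn // -/(euler_prod s.+1 n).
  rewrite (_ : s.+1 * n.+1 + 'C(s.+2, 2) = s.+1 * n.+1 + 'C(s.+1, 2) + s.+1)%N; last first.
    by rewrite [in LHS]binS bin1 addnA.
  rewrite (_ : s.+1 * n + 'C(s.+2, 2) = s.+1 * n.+1 + 'C(s.+1, 2))%N; last first.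
    by rewrite [in LHS]binS bin1; lia.
  move: (s.+1 * n.+1 + _)%N => A.
  by rewrite [(-1) ^+ s.+1]exprS exprD; move: 'X^(s.+1) => Y; ring.
rewrite /shanks_sum big_nat_recr //= [euler_prod n.+1 n.+1]big_geq // mulr1.
have -> : \sum_(0 <= s < n.+1) (-1) ^+ s * euler_prod s n.+1 * 'X^(s * n.+1 + 'C(s.+1, 2)) =
          \sum_(0 <= s < n.+1) (u s - v s).
  apply: eq_big_nat => s /andP[_ sn].
  rewrite /euler_prod big_nat_recr //= -/(euler_prod s n) /u /v mulSn -addnA.
  move: (s * n.+1 + _)%N => A; rewrite exprD; move: 'X^(n.+1) => Y; ring.
have -> : \sum_(0 <= s < n.+1) (u s - v s) = \sum_(0 <= s < n.+1) f s - v n.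
  (* The induction is on the summation bound alone; [n] stays fixed inside [f], [u] and [v]. *)
  elim: {-2}n (leqnn n) => [|m IH] mn; first by rewrite !big_nat1 /u /f !mul0n.
  rewrite big_nat_recr //= IH ?(ltnW mn) // [in RHS]big_nat_recr //=.
  by rewrite -[f m.+1](subrK (u m.+1)) fu //; ring.
rewrite -/(f _) -addrA; congr (_ + _).
rewrite /v [euler_prod n n]big_geq // mulr1 exprS; ring.
Qed.

Lemma shanks_sum_eqX n : eqX n.+1 (shanks_sum n) (euler_prod 0 n).
Proof.
move=> i iN; rewrite /shanks_sum big_nat_recl // coefD coef_sum /=.
rewrite mul0n add0n bin_small // expr0 mulr1 mul1r big_nat big1 ?addr0 // => s /andP[_ sn].
by rewrite coefMXn (_ : (i < _)%N) // mulSn; have := bin_gt0 s.+2 2; lia.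
Qed.

Lemma bin2_mul2 n : ('C(n.+1, 2) * 2 = n.+1 * n)%N.
Proof. by elim: n => // n IH; rewrite binS bin1 mulnDl IH; lia. Qed.

Lemma sg_nat n : sg n%:Z = (-1) ^+ n.
Proof.
elim: n => // n IH; rewrite exprS -IH mulN1r.
by rewrite /sg; lia.
Qed.

(** The two monomials gained at each step have exponents [pent (n+1)] and [pent (-(n+1))], the two
    indices that [zball] gains. *)
Lemma shanks_sum_pent n : shanks_sum n = \sum_(k <- zball n) sg k *: 'X^(pent k).
Proof.
elim: n => [|n IH].
  by rewrite /shanks_sum big_nat1 big_seq1 /euler_prod big_geq // !mulr1 scale1r.
rewrite shanks_sumS IH /= !big_cons.
have := bin2_mul2 n.+1; have := bin2_mul2 n => b1 b2.
have -> : pent n.+1%:Z = (n.+1 * n.+1 + 'C(n.+1, 2))%N.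
  by apply/eqP; rewrite -eqz_nat; apply/eqP; have := pent2 n.+1%:Z; lia.
have -> : pent (- n.+1%:Z) = (n.+1 * n.+1 + 'C(n.+2, 2))%N.
  by apply/eqP; rewrite -eqz_nat; apply/eqP; have := pent2 (- n.+1%:Z); lia.
have -> : sg (- n.+1%:Z) = sg n.+1%:Z by rewrite /sg; lia.
rewrite addrC mulrDr -addrA sg_nat -!mul_polyC polyC_exp polyCN; congr (_ * _ + (_ * _ + _)).
Qed.

Lemma coef_shanks_sum n i :
  (shanks_sum n)`_i = \sum_(k <- zball n) (if pent k == i then sg k else 0).
Proof.
rewrite shanks_sum_pent coef_sum; apply: eq_bigr => k _.
by rewrite coefZ coefXn eq_sym; case: eqP; rewrite ?mulr1 ?mulr0.
Qed.

Definition nb_regular_poly (l K M : nat) : {poly int} := \poly_(i < K) (nb_regular l M i)%:Z.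

(** By the recurrence [nb_regularS], multiplying by [1 - 'X^(M+1)] removes the partitions using the
    part [M+1], which undoes one inductive step. *)
Lemma nb_regular_prod l K M :
  eqX K (nb_regular_poly l K M * \prod_(0 <= i < M | ~~ (l %| i.+1)%N) (1 - 'X^(i.+1))) 1.
Proof.
elim: M => [|M IH].
  by move=> i iK; rewrite big_geq // mulr1 coef_poly iK nb_regular0 coef1; case: eqP.
rewrite big_mkcond big_nat_recr //= -big_mkcond /=.
set P := \prod_(_ <= i < _ | _) _ in IH *.
rewrite [P * _]mulrC mulrA; apply: eqX_trans IH; apply: eqX_mul => i iK.
case: ifP => lM; last first.
  by rewrite mulr1 !coef_poly iK nb_regularS lM addn0.
rewrite mulrBr mulr1 coefB coefMXn !coef_poly iK nb_regularS lM /=.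
rewrite (leq_ltn_trans (leq_subr _ _) iK) ltnS; case: leqP => iM.
  by rewrite subr0 addn0.
by rewrite PoszD addrK.
Qed.

(** Among [l] consecutive exponents ending at [l(n+1)], only the last is a multiple of [l]. *)
Lemma prod_comp_Xn l n : (0 < l)%N ->
  \prod_(0 <= i < l * n | (l %| i.+1)%N) (1 - 'X^(i.+1)) = euler_prod 0 n \Po 'X^l.
Proof.
move=> l0; elim: n => [|n IH].
  by rewrite muln0 /euler_prod !big_geq // rmorph1.
rewrite /euler_prod big_nat_recr //= rmorphM /= -/(euler_prod 0 n) -IH.
rewrite (big_cat_nat (n := (l * n)%N)) //=; last by rewrite leq_mul2l leqnSn orbT.
congr (_ * _).
rewrite rmorphB rmorph1 /= comp_Xn_poly -exprM.
rewrite (_ : l * n.+1 = (l * n + l.-1).+1)%N; last by lia.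
rewrite big_mkcond big_nat_recr /=; last by lia.
rewrite big_nat big1 ?mul1r.
  rewrite -addnS prednK // (_ : l * n + l = l * n.+1)%N; last by lia.
  by rewrite dvdn_mulr.
move=> i /andP[i1 i2]; rewrite (_ : (l %| i.+1)%N = false) //.
apply/negP => /dvdnP[q iE]; have : (l * n < q * l < l * n.+1)%N by lia.
by rewrite [(q * l)%N]mulnC !ltn_pmul2l //; lia.
Qed.

Lemma zball_widen (V : nmodType) (M L : nat) (F : int -> V) : (M <= L)%N ->
    (forall k : int, F k != 0 -> k \in zball M) ->
  \sum_(k <- zball M) F k = \sum_(k <- zball L) F k.
Proof.
move=> ML supp; apply: (@reindex_support _ _ _ _ _ id id); rewrite ?zball_uniq //.
  by move=> k kM _; split=> //; move: kM; rewrite !mem_zball; lia.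
by move=> k _ /supp.
Qed.

Lemma pent_bound k : - (pent k)%:Z <= k <= (pent k)%:Z.
Proof.
have := pent2 k; have := mul_pred_ge0 k; have := mul_pred_ge0 (k + 1); lia.
Qed.

(** Splitting the factors of [E] by divisibility of the exponent by [l] gives [E(q) B(q) = E(q^l)]
    up to [q^n]; both copies of [E] are then expanded by the pentagonal theorem. The bound [l * L]
    makes the multiples of [l] exactly [l, 2l, ..., lL]. *)
Lemma pent_conv_b l L n : (0 < l)%N -> (n <= L)%N ->
  pent_conv (l * L) (fun m => (b l m)%:Z) n =
  \sum_(k <- zball (l * L)) (if (l * pent k == n)%N then sg k else 0).
Proof.
move=> l0 nL; have lL : (L <= l * L)%N by rewrite leq_pmull.
have pn := @nb_regular_prod l n.+1 (l * L).
set P := \prod_(_ <= i < _ | _) _ in pn.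
have PE : P * (euler_prod 0 L \Po 'X^l) = euler_prod 0 (l * L).
  by rewrite -prod_comp_Xn // /euler_prod [RHS](bigID (fun i => l %| i.+1)%N) /= mulrC.
have e1 : (nb_regular_poly l n.+1 (l * L) * euler_prod 0 (l * L))`_n = (euler_prod 0 L \Po 'X^l)`_n.
  by rewrite -PE mulrA (eqX_mul _ pn) ?mul1r.
have -> : pent_conv (l * L) (fun m => (b l m)%:Z) n =
    (nb_regular_poly l n.+1 (l * L) * euler_prod 0 (l * L))`_n.
  rewrite mulrC -(@eqX_mul n.+1 (shanks_sum (l * L))) //; last first.
    by move=> i iN; rewrite shanks_sum_eqX //; lia.
  rewrite shanks_sum_pent mulr_suml coef_sum; apply: eq_bigr => k _.
  rewrite -scalerAl coefZ coefXnM coef_poly; case: ltnP => kn; rewrite ?mulr0 //.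
  rewrite ltnS leq_subr (@b_nb_regular _ (l * L)) //; lia.
rewrite e1 coef_comp_poly_Xn //; case: ifP => [/dvdnP[q qE]|ln].
  have qL : (q <= L)%N by apply: leq_trans nL; rewrite qE leq_pmulr.
  rewrite qE mulnK // -shanks_sum_eqX //.
  rewrite coef_shanks_sum (zball_widen lL).
    by apply: eq_bigr => k _; rewrite mulnC eqn_pmul2r.
  move=> k; case: (_ =P q) => // kq _; rewrite mem_zball.
  by have := pent_bound k; rewrite kq; lia.
rewrite big1 // => k _; case: eqP => // e.
by rewrite -e dvdn_mulr in ln.
Qed.

End Pentagonal.

(** * The divisor sum modulo 3 *)

Section Congruence.
Local Open Scope ring_scope.

(** Strong induction: the [k = 0] term of the convolution is the value at [n], and every other index
    has [pent k > 0], hence involves earlier values only. *)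
Lemma pent_conv_inj_mod (d : int) (f g : nat -> int) :
    (forall n, exists L, exists z, pent_conv L f n = pent_conv L g n + d * z) ->
  forall n, (d %| f n - g n)%Z.
Proof.
move=> fg; elim/ltn_ind => n IH; have [L [z E]] := fg n.
have L0 : (0 : int) \in zball L by rewrite mem_zball; lia.
have : (d %| pent_conv L f n - pent_conv L g n)%Z by rewrite E addrAC subrr add0r dvdz_mulr.
rewrite /pent_conv -sumrB (bigD1_seq 0) ?zball_uniq //= (_ : pent 0 = 0)%N //.
rewrite subn0 (_ : sg 0 = 1) // !mul1r rpredDr ?rpred_sum // => k k0.
case: leqP => kn; last by rewrite subrr dvdz0.
rewrite -mulrBr dvdz_mull // IH //.
have k1 : (0 < pent k)%N by have := pent_bound k; lia.
by lia.
Qed.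

Lemma b9_chi3_sum n : (3 %| (b 9 n)%:Z - chi3_sum n)%Z.
Proof.
(* The bound is a multiple of 9 for [pent_conv_b] and at least [6n + 20] for
   [pent_conv_chi3_sum]. *)
move: n; apply: pent_conv_inj_mod => n; exists (9 * (6 * n + 20))%N.
have [|z ->] := @pent_conv_chi3_sum (9 * (6 * n + 20)) n; first by lia.
exists (- z); rewrite pent_conv_b //; last by lia.
by rewrite mulrN addrK.
Qed.

End Congruence.

(** * Multiplicativity of the divisor sum and its prime divisors *)

Definition divisor_sum (n : nat) := \sum_(d <- divisors n) d.

Section DivisorSum.
Local Open Scope ring_scope.

Lemma b9_divisor_sum n : (b 9 n = divisor_sum (3 * n + 1) %[mod 3])%N.
Proof.
have : (3 %| (b 9 n)%:Z - (divisor_sum (3 * n + 1))%:Z)%Z.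
  rewrite -[_ - _](subrKA (chi3_sum n)) rpredD ?b9_chi3_sum //.
  have -> : (divisor_sum (3 * n + 1))%:Z = \sum_(d <- divisors (3 * n + 1)) d%:Z.
    by rewrite -[LHS]intz sumMz; apply: eq_bigr => d _; rewrite intz.
  rewrite /chi3_sum -sumrB rpred_sum // => d _.
  by change (_ \in _) with (3 %| chi3 d - d%:Z)%Z; rewrite /chi3; lia.
lia.
Qed.

End DivisorSum.

Lemma divisor_sum_coprime m n : coprime m n -> 0 < m -> 0 < n ->
  divisor_sum (m * n) = divisor_sum m * divisor_sum n.
Proof.
move=> co m0 n0; rewrite /divisor_sum big_distrlr /=.
transitivity (\sum_(p <- [seq (x, y) | x <- divisors m, y <- divisors n]) p.1 * p.2); last first.
  by rewrite big_allpairs.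
apply/esym.
have mn0 : 0 < m * n by rewrite muln_gt0 m0.
apply: (@reindex_support _ _ _ _ _
  (fun p : nat * nat => p.1 * p.2) (fun d => (gcdn d m, gcdn d n))).
- by apply: allpairs_uniq; rewrite ?divisors_uniq // => -[? ?] [? ?] _ _ /= [-> ->].
- exact: divisors_uniq.
- move=> _ /allpairsP[[x y] /= [+ + ->]] _ /=; rewrite -!dvdn_divisors // => xm yn.
  rewrite dvdn_mul // ![gcdn (x * y) _]gcdnC Gauss_gcdl ?Gauss_gcdr.
  + by rewrite !(gcdnC _ x) !(gcdnC _ y) (gcdn_idPl xm) (gcdn_idPl yn).
  + by rewrite coprime_sym; apply: coprime_dvdl xm co.
  + by apply: coprime_dvdr yn co.
- move=> d; rewrite -dvdn_divisors // => dmn _ /=.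
  have dE : gcdn d m * gcdn d n = d.
    apply/eqP; rewrite eqn_dvd; apply/andP; split.
      rewrite Gauss_dvd ?dvdn_gcdl //.
      exact: coprime_dvdl (dvdn_gcdr _ _) (coprime_dvdr (dvdn_gcdr _ _) co).
    (* The product of the gcds is the gcd of [d * d], [m * d], [d * n] and [m * n], all multiples of
       [d]. *)
    rewrite muln_gcdr !muln_gcdl !dvdn_gcd dmn.
    by rewrite (dvdn_mulr d (dvdnn d)) (dvdn_mull m (dvdnn d)) (dvdn_mulr n (dvdnn d)).
  split=> //; apply/allpairsP; exists (gcdn d m, gcdn d n).
  by rewrite /= -!dvdn_divisors ?dvdn_gcdr.
Qed.

Lemma divisor_sum_pfactor p e : prime p -> divisor_sum (p ^ e) = \sum_(i < e.+1) p ^ i.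
Proof.
move=> pp; rewrite /divisor_sum -(big_mkord xpredT (fun i => p ^ i)) /index_iota subn0.
rewrite -(big_map (expn p) xpredT id); apply/perm_big/uniq_perm.
- exact: divisors_uniq.
- by rewrite map_inj_uniq ?iota_uniq //; apply: expnI; apply: prime_gt1.
- move=> d; rewrite -dvdn_divisors ?expn_gt0 ?prime_gt0 //.
  apply/(dvdn_pfactor _ _ pp)/mapP => -[i ie ->]; exists i => //.
    by rewrite mem_iota.
  by move: ie; rewrite mem_iota.
Qed.

(** Induction splitting off the full power of the least prime factor, with Euclid's lemma for [q]. A
    prime not dividing [n] has sum 1, so it is never a witness. *)
Lemma dvd_divisor_sum q n : prime q -> 0 < n ->
  (q %| divisor_sum n) <-> exists2 p, prime p & q %| \sum_(i < (logn p n).+1) p ^ i.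
Proof.
move=> pq; elim/ltn_ind: n => n IH n0.
have q1 : (q %| 1) = false by rewrite dvdn1; case: eqP pq => // ->.
have sum0 p : (q %| \sum_(i < 1) p ^ i) = false by rewrite big_ord1.
have [n1|n1] := leqP n 1.
  have -> : n = 1 by lia.
  rewrite /divisor_sum big_seq1 q1.
  by split=> // -[p pp]; rewrite logn1 sum0.
have pp := pdiv_prime n1; set p := pdiv n in pp.
have [m com nE] := pfactor_coprime pp n0.
have m0 : 0 < m by move: n0; rewrite nE muln_gt0 => /andP[].
have e0 : 0 < logn p n by rewrite logn_gt0 mem_primes pp n0 pdiv_dvd.
have p1 := prime_gt1 pp.
have mn : m < n by rewrite nE -[X in X < _]muln1 ltn_pmul2l // -(expn0 p) ltn_exp2l.
have lognE r : prime r -> r != p -> logn r n = logn r m.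
  move=> pr rp; rewrite nE lognM ?expn_gt0 ?(ltnW p1) // lognX.
  by rewrite (logn_prime _ pp) (negbTE rp) muln0 addn0.
have lognp0 : logn p m = 0 by apply: logn_coprime.
rewrite {1}nE divisor_sum_coprime ?expn_gt0 ?(ltnW p1) //; last first.
  by rewrite coprime_sym coprimeXl.
rewrite divisor_sum_pfactor // Euclid_dvdM //; split.
  move=> /orP[/(IH m mn m0)[r pr]|]; last by exists p.
  have [->|rp] := eqVneq r p; first by rewrite lognp0 sum0.
  by rewrite -lognE //; exists r.
move=> [r pr]; have [->|rp] := eqVneq r p; first by move=> ->; rewrite orbT.
by rewrite lognE // => h; apply/orP; left; apply/(IH m mn m0); exists r.
Qed.

Lemma sum_expn_mod p e d : \sum_(i < e) p ^ i = \sum_(i < e) (p %% d) ^ i %[mod d].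
Proof.
by rewrite -modn_summ -[RHS]modn_summ; congr (_ %% _); apply: eq_bigr => i _; rewrite modnXm.
Qed.

Lemma dvd3_sum_expn p e : (3 %| \sum_(i < e.+1) p ^ i) =
  ((p %% 3 == 2) && odd e) || ((p %% 3 == 1) && (e %% 3 == 2)).
Proof.
rewrite /dvdn sum_expn_mod; have : p %% 3 < 3 by rewrite ltn_mod.
case: (p %% 3) => [|[|[|]]] //= _.
- by rewrite big_ord_recl big1 // => i _; rewrite exp0n.
- rewrite (eq_bigr (fun => 1)); last by move=> i _; rewrite exp1n.
  by rewrite sum1_card card_ord; lia.
- rewrite orbF.
  (* The residue of [2 ^ e], alternating between 1 and 2, is carried along to make the induction
     close. *)
  suff : (\sum_(i < e.+1) 2 ^ i) %% 3 = ~~ odd e /\ 2 ^ e %% 3 = (odd e).+1 by lia.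
  elim: e => [|e [IH1 IH2]]; first by rewrite big_ord1.
  rewrite big_ord_recr /= expnS; move: (bigop _ _ _) (2 ^ e) IH1 IH2 => x y.
  by case: (odd e) => /= ? ?; lia.
Qed.

Theorem theorem1p1 (n : nat) :
  3 %| b 9 n <->
  (exists p : nat,
     [/\ prime p, p = 2 %[mod 3] & odd (logn p (3 * n + 1))])
  \/
  (exists p : nat,
     [/\ prime p, p = 1 %[mod 3] & logn p (3 * n + 1) = 2 %[mod 3]]).
Proof.
have -> : 3 %| b 9 n = (3 %| divisor_sum (3 * n + 1)) by rewrite /dvdn b9_divisor_sum.
rewrite dvd_divisor_sum //; last by lia.
split=> [[p pp]|[[p [pp p3 e]]|[p [pp p3 e]]]].
- rewrite dvd3_sum_expn => /orP[/andP[/eqP p3 e]|/andP[/eqP p3 /eqP e]].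
    by left; exists p.
  by right; exists p.
- by exists p => //; rewrite dvd3_sum_expn p3 e.
- by exists p => //; rewrite dvd3_sum_expn p3 e.
Qed.
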